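(* Let $\vec v\in\mathbb{R}_+^n$ be a basis of a number field $K$ of degree $n$ (as a vector space over $\mathbb{Q}$), and let $\widehat{\vec v}\neq\vec v$ be a conjugate vector of $\vec v$. Suppose that $\vec v$ has a purely periodic expansion in some unimodular weakly convergent Jacobi--Perron type $(n-1)$-dimensional continued fraction algorithm. Then $\widehat{\vec v}\notin\mathbb{R}_+^n$.
   Context: $\mathbb{R}_+$ denotes the positive reals. A conjugate vector of $\vec v=(v_1,\dots,v_n)^T$ is $\widehat{\vec v}=(\sigma(v_1),\dots,\sigma(v_n))^T$ for some field embedding $\sigma\colon K=\mathbb{Q}(v_1,\dots,v_n)\to\mathbb{C}$. A Jacobi--Perron type $(n-1)$-dimensional MCF algorithm is given by an at most countable family $\mathcal I=\{I_1,I_2,\dots\}$ of pairwise disjoint subsets of $\mathbb{R}_+^n$ with $\alpha I\subseteq I$ for all $\alpha>0$, and a family $\mathcal A=\{A_1,A_2,\dots\}$ (same index set) of invertible real $n\times n$ matrices such that no product of matrices from $\mathcal A$ equals the identity. For $\vec v\in\mathbb{R}_+^n$ set $\vec v^{(0)}=\vec v$; at step $i$, if $\vec v^{(i)}\in I_j$ put $A^{(i)}=A_j$, $\vec v^{(i+1)}=A_j^{-1}\vec v^{(i)}$ (stop if no such $j$). The sequence $(A^{(i)})$ is the expansion. It is purely periodic if $\vec v^{(0)}=\lambda\vec v^{(p)}$ for some $p\ge1$ and real $\lambda$. The algorithm is unimodular if all matrices in $\mathcal A$ are integer matrices with determinant $\pm1$. It is weakly convergent if for every $\vec v\in\mathbb{R}_+^n$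 with (infinite) expansion $(A^{(0)},A^{(1)},\dots)$, setting $M^{(s)}=A^{(0)}\cdots A^{(s)}$: there is $\widetilde P$ with $M^{(s)}$ having all entries positive for all $s>\widetilde P$, and for every column $j$ and all $i,k$, $M^{(s)}_{i,j}/M^{(s)}_{k,j}\to v_i/v_k$ as $s\to\infty$.
   Formalization: A purely periodic expansion is required to be infinite (the algorithm never stops on v, so λ > 0); with negative λ allowed, the algorithm stops at step p, weak convergence says nothing, and the statement fails. *)

(* Defs.v *)
From HB Require Import structures.
From mathcomp Require Import all_boot all_order all_algebra all_field.
From mathcomp Require Import all_classical all_reals all_analysis.
From mathcomp Require Import complex.

Set Implicit Arguments.
Unset Strict Implicit.
Unset Printing Implicit Defensive.

Import Order.TTheory GRing.Theory Num.Theory.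
Import numFieldNormedType.Exports.
Local Open Scope classical_set_scope.
Local Open Scope ring_scope.

Definition posvec (R : realType) (n : nat) : set 'cV[R]_n :=
  [set v | forall i, 0 < v i 0].

Definition complexvec (R : realType) (n : nat) (v : 'cV[R]_n) : 'cV[R[i]]_n :=
  map_mx (real_complex R) v.

(* The field Q(v_1, ..., v_n), as the smallest subfield of R containing the
   entries of v: over a field, [divring_closed] means being a subfield. *)
Definition entries_field (R : realType) (n : nat) (v : 'cV[R]_n) : set R :=
  [set x | forall F : {pred R}, divring_closed F ->
             (forall i, v i 0 \in F) -> x \in F].

(* sigma is total, but only its restriction to F is constrained. *)
Definition field_embedding (R : realType) (F : set R) (sigma : R -> R[i]) : Prop :=
  [/\ sigma 1 = 1,
      forall x y, F x -> F y -> sigma (x + y) = sigma x + sigma y &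
      forall x y, F x -> F y -> sigma (x * y) = sigma x * sigma y].

Definition conjugate_vector (R : realType) (n : nat)
    (v : 'cV[R]_n) (w : 'cV[R[i]]_n) : Prop :=
  exists2 sigma : R -> R[i],
    field_embedding (entries_field v) sigma & w = map_mx sigma v.

(* Jacobi-Perron type (n-1)-dimensional MCF algorithms; both families are
   indexed by the same at most countable type. In [mcf_prod_neq1] the empty
   product, which is the identity by convention, has to be excluded. *)
Record mcf_algorithm (R : realType) (n : nat) := MCFAlgorithm {
  mcf_index : countType;
  mcf_dom : mcf_index -> set 'cV[R]_n;
  mcf_mx : mcf_index -> 'M[R]_n;
  mcf_dom_pos : forall j, mcf_dom j `<=` posvec (R := R) (n := n);
  mcf_dom_disjoint : forall j k, j != k -> mcf_dom j `&` mcf_dom k = set0;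
  mcf_dom_cone : forall j (alpha : R) x,
    0 < alpha -> mcf_dom j x -> mcf_dom j (alpha *: x);
  mcf_mx_unit : forall j, mcf_mx j \in unitmx;
  mcf_prod_neq1 : forall s : seq mcf_index,
    s != [::] -> \prod_(j <- s) mcf_mx j != 1%:M
}.

Section Expansion.
Variables (R : realType) (n : nat) (alg : mcf_algorithm R n).

(* v^(s), when A^(i) = A_(a i) for all i < s. *)
Fixpoint mcf_orbit (a : nat -> mcf_index alg) (v : 'cV[R]_n) (s : nat) : 'cV[R]_n :=
  if s is s'.+1 then invmx (mcf_mx (a s')) *m mcf_orbit a v s' else v.

(* The algorithm never stops on v, and a lists the indices j chosen at the
   successive steps (they are determined by v, the domains being disjoint). *)
Definition infinite_expansion (v : 'cV[R]_n) (a : nat -> mcf_index alg) : Prop :=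
  posvec v /\ forall s, mcf_dom (a s) (mcf_orbit a v s).

(* A periodic expansion is an infinite one. This matters: without it, lambda
   could be negative and the algorithm would stop at step p. *)
Definition purely_periodic_expansion (v : 'cV[R]_n) : Prop :=
  exists2 a : nat -> mcf_index alg, infinite_expansion v a &
    exists p : nat, exists lambda : R,
      (0 < p)%N /\ mcf_orbit a v 0 = lambda *: mcf_orbit a v p.

Definition unimodular : Prop :=
  forall j : mcf_index alg,
    (forall i k, mcf_mx j i k \is a Num.int) /\
    (\det (mcf_mx j) = 1 \/ \det (mcf_mx j) = -1).

Definition mcf_convergent_mx (a : nat -> mcf_index alg) (s : nat) : 'M[R]_n :=
  \prod_(i < s.+1) mcf_mx (a i).

Definition weakly_convergent : Prop :=
  forall (v : 'cV[R]_n) (a : nat -> mcf_index alg), infinite_expansion v a ->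
    (exists P : nat, forall s, (P < s)%N ->
       forall i j, 0 < mcf_convergent_mx a s i j) /\
    (forall i j k : 'I_n,
       (fun s => mcf_convergent_mx a s i j / mcf_convergent_mx a s k j) @ \oo
         --> v i 0 / v k 0).

End Expansion.

(* Main.v *)
Require Import Defs.
From HB Require Import structures.
From mathcomp Require Import all_boot all_order all_algebra all_field.
From mathcomp Require Import all_classical all_reals all_analysis.
From mathcomp Require Import complex.

Set Implicit Arguments.
Unset Strict Implicit.
Unset Printing Implicit Defensive.

Import Order.TTheory GRing.Theory Num.Theory.
Import numFieldNormedType.Exports.
Local Open Scope classical_set_scope.
Local Open Scope ring_scope.

(** A period matrix [M] has integer entries and [v] as an eigenvector, so the
    conjugate vector is an eigenvector of [M] too. Weak convergence forces a
    positive eigenvector [u] of [M] to be proportional to [v], because [M ^ k u]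
    is a positive combination of columns of [M ^ k], whose directions all tend to
    that of [v]. As [1] is a rational combination of the entries of [v], its
    image under the embedding shows that the factor is [1], hence [u = v]. *)

(** * Field generated by the entries of [v], and its embeddings *)

Section EntriesField.
Variables (R : realType) (n : nat) (v : 'cV[R]_n).
Implicit Types x y : R.
Let F := entries_field v.

Lemma entries_field_entry i : F (v i 0).
Proof. by move=> S _; apply. Qed.

Lemma entries_field1 : F 1.
Proof. by move=> S [S1 _ _]. Qed.

Lemma entries_fieldB x y : F x -> F y -> F (x - y).
Proof.
move=> Fx Fy S cS vS; case: (cS) => _ SB _.
by apply: SB; [exact: Fx | exact: Fy].
Qed.

Lemma entries_field_div x y : F x -> F y -> F (x / y).
Proof.
move=> Fx Fy S cS vS; case: (cS) => _ _ SV.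
by apply: SV; [exact: Fx | exact: Fy].
Qed.

Lemma entries_field0 : F 0.
Proof. by rewrite -(subrr 1); apply: entries_fieldB; exact: entries_field1. Qed.

Lemma entries_fieldN x : F x -> F (- x).
Proof. by move=> Fx; rewrite -sub0r; apply: entries_fieldB => //; exact: entries_field0. Qed.

Lemma entries_fieldD x y : F x -> F y -> F (x + y).
Proof. by move=> Fx Fy; rewrite -[y]opprK; apply/entries_fieldB/entries_fieldN. Qed.

(** [divring_closed] only provides [1], differences and quotients, so the product is obtained as
    [x / (1 / y)]; the convention [0^-1 = 0] covers [y = 0]. *)
Lemma entries_fieldM x y : F x -> F y -> F (x * y).
Proof.
move=> Fx Fy; rewrite -[y]invrK -[y^-1]mul1r.
by do 2?[apply: entries_field_div => //]; exact: entries_field1.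
Qed.

Lemma entries_field_nat m : F m%:R.
Proof.
elim: m => [|m IHm]; first exact: entries_field0.
by rewrite -natr1; apply: entries_fieldD => //; exact: entries_field1.
Qed.

Lemma entries_field_int (m : int) : F m%:~R.
Proof.
case: m => m; first exact: entries_field_nat.
by rewrite NegzE mulrNz; apply/entries_fieldN/entries_field_nat.
Qed.

Lemma entries_field_rat (q : rat) : F (ratr q).
Proof. by apply: entries_field_div; exact: entries_field_int. Qed.

Variable sigma : R -> R[i].
Hypothesis sigmaP : field_embedding F sigma.

Lemma embedding0 : sigma 0 = 0.
Proof.
case: sigmaP => _ sD _; apply: (@addrI _ (sigma 0)).
by rewrite -sD ?addr0 //; exact: entries_field0.
Qed.

Lemma embeddingN x : F x -> sigma (- x) = - sigma x.
Proof.
case: sigmaP => _ sD _ Fx; apply: (@addrI _ (sigma x)).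
by rewrite -sD ?subrr ?embedding0 //; exact: entries_fieldN.
Qed.

Lemma embedding_nat m : sigma m%:R = m%:R.
Proof.
case: sigmaP => s1 sD _; elim: m => [|m IHm]; first exact: embedding0.
by rewrite -!natr1 sD ?IHm ?s1 //; [exact: entries_field_nat | exact: entries_field1].
Qed.

Lemma embedding_int (m : int) : sigma m%:~R = m%:~R.
Proof.
case: m => m; first exact: embedding_nat.
by rewrite NegzE !mulrNz embeddingN ?embedding_nat //; exact: entries_field_nat.
Qed.

Lemma embedding_rat (q : rat) : sigma (ratr q) = ratr q.
Proof.
(* Kept generic in [L] because the denominator is cleared both in [R] and in [R[i]]. *)
have d0 (L : numFieldType) : (denq q)%:~R != 0 :> L by rewrite intr_eq0 denq_neq0.
case: sigmaP => _ _ sM; apply: (mulIf (d0 _)).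
rewrite -[in LHS](embedding_int (denq q)) -sM.
- by rewrite /ratr !divfK ?d0 //; exact: embedding_int.
- exact: entries_field_rat.
- exact: entries_field_int.
Qed.

(** Membership and image go through one induction: [sigma] is additive only on [F], so each step
    needs the partial sum to lie in [F]. *)
Lemma embedding_rat_comb (q : 'I_n -> rat) :
  F (\sum_i ratr (q i) * v i 0) /\
  sigma (\sum_i ratr (q i) * v i 0) = \sum_i ratr (q i) * sigma (v i 0).
Proof.
case: sigmaP => _ sD sM; elim/big_rec2: _ => [|i y z _ [Fz <-]].
  by rewrite embedding0; split => //; exact: entries_field0.
have Fqv := entries_fieldM (entries_field_rat (q i)) (entries_field_entry i).
split; first exact: entries_fieldD.
by rewrite sD // sM ?embedding_rat //; exact: entries_field_rat.
Qed.

End EntriesField.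

(** * Real conjugate vectors and integer matrices *)

Section ConjugateReal.
Variables (R : realType) (n : nat) (v u : 'cV[R]_n) (sigma : R -> R[i]).
Hypotheses (sigmaP : field_embedding (entries_field v) sigma)
           (sigma_v : map_mx sigma v = complexvec u).

Lemma embedding_entry i : sigma (v i 0) = real_complex R (u i 0).
Proof. by have /matrixP/(_ i 0) := sigma_v; rewrite !mxE. Qed.

Lemma embedding_rat_comb_real (q : 'I_n -> rat) :
  sigma (\sum_i ratr (q i) * v i 0) = real_complex R (\sum_i ratr (q i) * u i 0).
Proof.
have [_ ->] := embedding_rat_comb sigmaP q.
rewrite rmorph_sum; apply: eq_bigr => i _.
by rewrite rmorphM /= embedding_entry fmorph_rat.
Qed.

(** Applying [sigma] to each row of [M *m v = lambda *: v] fixes the integer entries of [M] and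
    gives the eigenvalue [sigma lambda] for [u]. *)
Lemma conjugate_eigenvector (M : 'M[R]_n) (lambda : R) :
  (forall i j, M i j \is a Num.int) -> posvec v -> posvec u ->
  M *m v = lambda *: v -> exists mu, M *m u = mu *: u.
Proof.
move=> Mint v0 u0 Mv; pose q i j : rat := (Num.floor (M i j))%:~R.
have Mq i j : M i j = ratr (q i j) by rewrite /q ratr_int floorK.
have Mx (x : 'cV[R]_n) i : (M *m x) i 0 = \sum_j ratr (q i j) * x j 0.
  by rewrite mxE; apply: eq_bigr => j _; rewrite Mq.
case: (pickP 'I_n) => [l _|n0]; last first.
  by exists 0; apply/matrixP => i; have := n0 i.
have Fl : entries_field v lambda.
  have -> : lambda = (M *m v) l 0 / v l 0 by rewrite Mv mxE mulfK // gt_eqF.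
  apply: entries_field_div; last exact: entries_field_entry.
  by rewrite Mx; have [] := embedding_rat_comb sigmaP (q l).
have sMu i : real_complex R ((M *m u) i 0) = sigma lambda * real_complex R (u i 0).
  case: sigmaP => _ _ sM; rewrite Mx -embedding_rat_comb_real -Mx Mv mxE sM //.
  by rewrite embedding_entry.
(* [sigma lambda] is a priori only complex, so a real eigenvalue is read off from coordinate [l];
   the other coordinates follow by cross-multiplication in [R[i]]. *)
exists ((M *m u) l 0 / u l 0); apply/matrixP => i k; rewrite ord1 [RHS]mxE.
apply: (@mulIf _ (u l 0)); first by rewrite gt_eqF.
rewrite mulrAC divfK ?gt_eqF //; apply: (fmorph_inj (real_complex R)).
by rewrite !rmorphM /= !sMu mulrAC.
Qed.

End ConjugateReal.

(* A failure [u i / u l < v i / v l] would make [M s i j / M s l j > u i / u l]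
   for every [j] and large [s], which the eigenvector equation forbids. *)
Lemma eigenvector_ratio (R : realType) (n : nat) (M : nat -> 'M[R]_n)
    (u v : 'cV[R]_n) (i l : 'I_n) :
  posvec u -> posvec v ->
  (\forall s \near \oo, forall i j, 0 < M s i j) ->
  (forall j, (fun s => M s i j / M s l j) @ \oo --> v i 0 / v l 0) ->
  (forall N, exists2 s, (N <= s)%N & exists mu, M s *m u = mu *: u) ->
  v i 0 / v l 0 <= u i 0 / u l 0.
Proof.
move=> u0 v0 Mpos Mcvg Meig; rewrite leNgt; apply/negP => lt_uv.
have lt_col : \forall s \near \oo, forall j, u i 0 / u l 0 < M s i j / M s l j.
  apply: filter_forall => j.
  exact: (cvgr_gt _ (Mcvg j) _ lt_uv).
have [N _ NP] : \forall s \near \oo, (forall i j, 0 < M s i j) /\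
    (forall j, u i 0 / u l 0 < M s i j / M s l j) by exact: filterI.
have [s Ns [mu Mu]] := Meig N; have [Ms0 Ms] := NP s Ns.
(* By the eigenvector equation both sides equal [mu * u i 0 * u l 0], so a strict inequality is
   absurd; it is then proved column by column. *)
suff : u i 0 * (M s *m u) l 0 < u l 0 * (M s *m u) i 0.
  by rewrite Mu !mxE mulrCA [ltRHS]mulrCA [u i 0 * _]mulrC ltxx.
rewrite !mxE !mulr_sumr; apply: ltr_sum => [|j _].
  by apply/hasP; exists i => //; rewrite mem_index_enum.
rewrite !mulrA ltr_pM2r //.
by have := Ms j; rewrite ltr_pdivrMr // mulrAC ltr_pdivlMr // [ltRHS]mulrC.
Qed.

(** * Products of matrices along a periodic expansion *)

Section Periodic.
Variables (R : realType) (n : nat) (alg : mcf_algorithm R n).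
Variables (a : nat -> mcf_index alg) (v : 'cV[R]_n).

Let P s : 'M[R]_n := \prod_(i < s) mcf_mx (a i).

Lemma mcf_prod_orbit s : P s *m mcf_orbit a v s = v.
Proof.
elim: s => [|s IHs]; first by rewrite /P big_ord0 mul1mx.
rewrite /P big_ord_recr /= -[_ * _]/(_ *m _) mulmxA mulmxK //.
exact: mcf_mx_unit.
Qed.

Lemma mcf_prod_int s : unimodular alg -> forall i j, P s i j \is a Num.int.
Proof.
move=> unim; elim: s => [|s IHs] i j.
  by rewrite /P big_ord0 mxE; case: (i == j).
rewrite /P big_ord_recr mxE; apply: rpred_sum => k _.
by apply: rpredM; [exact: IHs | have [] := unim (a s)].
Qed.

Hypothesis va : infinite_expansion v a.

Lemma mcf_index_periodic (p : nat) (c : R) : 0 < c ->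
  mcf_orbit a v p = c *: v -> forall s, a (p + s)%N = a s.
Proof.
move=> c0 pv.
(* Proportional orbit vectors lie in the same cone, and the cones are disjoint. Equal indices then
   carry the proportionality on to [s.+1]. *)
have step s : mcf_orbit a v (p + s) = c *: mcf_orbit a v s -> a (p + s)%N = a s.
  case: va => _ dom ps; apply/eqP/contraT => /mcf_dom_disjoint ne.
  have : (mcf_dom (a (p + s)%N) `&` mcf_dom (a s)) (mcf_orbit a v (p + s)).
    by split; [exact: dom | rewrite ps; apply: mcf_dom_cone].
  by rewrite ne.
move=> s; apply: (step); elim: s => [|s IHs]; first by rewrite addn0.
by rewrite addnS /= (step _ IHs) IHs -scalemxAr.
Qed.

Lemma mcf_prod_periodic p : (forall s, a (p + s)%N = a s) ->
  forall k, P (k * p) = iter k (mulmx (P p)) 1%:M.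
Proof.
move=> pa; elim=> [|k IHk]; first by rewrite /P mul0n big_ord0.
rewrite iterS -IHk mulSn /P big_split_ord; congr (_ *m _).
by apply: eq_bigr => i _ /=; rewrite pa.
Qed.

(** Products over whole periods are powers of [P p], so [u] is an eigenvector of infinitely many
    convergent matrices and [eigenvector_ratio] applies. *)
Lemma purely_periodic_positive_eigenvector (p : nat) (lambda : R) (u : 'cV[R]_n) :
  weakly_convergent alg -> (0 < p)%N -> v = lambda *: mcf_orbit a v p ->
  posvec u -> (exists mu, P p *m u = mu *: u) ->
  forall i l, u i 0 / u l 0 = v i 0 / v l 0.
Proof.
move=> wconv p0 pv u0 [mu Pu] i0 l0; have [[N Npos] Mcvg] := wconv v a va.
case: (va) => v0 dom.
have lam0 : 0 < lambda.
  have := v0 i0; rewrite pv mxE pmulr_lgt0 //.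
  exact: (mcf_dom_pos (dom p)).
have pa : forall s, a (p + s)%N = a s.
  apply: (@mcf_index_periodic p lambda^-1); first by rewrite invr_gt0.
  by rewrite [in RHS]pv scalerA mulVf ?scale1r // gt_eqF.
have Pk k : P (k * p) *m u = mu ^+ k *: u.
  rewrite mcf_prod_periodic //; elim: k => [|k IHk].
    by rewrite mul1mx scale1r.
  by rewrite iterS -mulmxA IHk -scalemxAr Pu scalerA exprSr.
have Meig N' : exists2 s, (N' <= s)%N &
    exists mu, mcf_convergent_mx a s *m u = mu *: u.
  (* [mcf_convergent_mx a s] has [s.+1] factors, hence the predecessor of a multiple of [p]. *)
  exists (N'.+1 * p).-1.
    by rewrite -ltnS prednK ?muln_gt0 // leq_pmulr.
  by exists (mu ^+ N'.+1); rewrite -Pk /mcf_convergent_mx prednK ?muln_gt0.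
have Mpos : \forall s \near \oo, forall i j, 0 < mcf_convergent_mx a s i j.
  by exists N.+1 => // s; exact: Npos.
have le i l := eigenvector_ratio u0 v0 Mpos (fun j => Mcvg i j l) Meig.
apply/eqP; rewrite eq_le le andbT.
(* Swapping [i] and [l] inverts both positive ratios, which gives the reverse inequality. *)
rewrite -[leLHS]invf_div -[leRHS]invf_div lef_pV2 ?posrE ?divr_gt0 //; exact: le.
Qed.

End Periodic.

(** The coordinates of [1] in the basis give a rational normalisation that singles out [v] among its
    multiples. *)
Lemma basis_rat_comb1 (R : realType) (n : nat) (K : fieldExtType rat)
    (iota : {rmorphism K -> R}) (b : n.-tuple K) :
  basis_of {:K} b -> exists q : 'I_n -> rat, \sum_i ratr (q i) * iota (tnth b i) = 1.
Proof.
move=> hb; exists (fun i => coord b i 1).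
rewrite -[RHS](rmorph1 iota) [in RHS](coord_basis hb (memvf 1)) rmorph_sum.
apply: eq_bigr => i _.
by rewrite -mulr_algl rmorphM /= -tnth_nth alg_num_field fmorph_rat.
Qed.

Theorem theorem4p8 (R : realType) (n : nat)
    (K : fieldExtType rat) (hK : \dim {:K} = n) (iota : {rmorphism K -> R})
    (b : n.-tuple K) (hb : basis_of {:K} b)
    (v : 'cV[R]_n) (hvb : forall i, v i 0 = iota (tnth b i)) (hv : posvec v)
    (w : 'cV[R[i]]_n) (hw : conjugate_vector v w) (hwv : w <> complexvec v)
    (alg : mcf_algorithm R n) (halg_unimod : unimodular alg)
    (halg_conv : weakly_convergent alg)
    (hper : purely_periodic_expansion alg v) :
  ~ (exists2 u : 'cV[R]_n, posvec u & w = complexvec u).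
Proof.
case=> u hu wu; case: hw => sigma sigmaP ws; apply: hwv; rewrite wu.
case: hper => a va [p [lambda [p0 pv]]]; rewrite /= in pv.
have sigma_v : map_mx sigma v = complexvec u by rewrite -ws.
have Pv : (\prod_(i < p) mcf_mx (a i)) *m v = lambda *: v.
  by rewrite {1}pv -scalemxAr mcf_prod_orbit.
have Pint := mcf_prod_int a p halg_unimod.
have Pu := conjugate_eigenvector sigmaP sigma_v Pint hv hu Pv.
have ratio := purely_periodic_positive_eigenvector va halg_conv p0 pv hu Pu.
congr complexvec; apply/matrixP => l k; rewrite ord1.
have [q q1] := basis_rat_comb1 iota hb.
have qv : \sum_i ratr (q i) * v i 0 = 1.
  by rewrite -q1; apply: eq_bigr => i _; rewrite hvb.
have qu : \sum_i ratr (q i) * u i 0 = 1.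
  apply: (fmorph_inj (real_complex R)); rewrite rmorph1.
  have := embedding_rat_comb_real sigmaP sigma_v q; rewrite qv.
  by case: sigmaP => -> _ _ /esym.
(* The inverses agree: [1 / u l 0] is the sum of the [ratr (q i) * (u i 0 / u l 0)], whose ratios
   are those of [v]. *)
apply: invr_inj; rewrite -[LHS]mul1r -[RHS]mul1r -{1}qu -qv !mulr_suml.
by apply: eq_bigr => i _; rewrite -!mulrA ratio.
Qed.
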